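(* Let $G=(V,E)$ be a finite simple strongly connected directed graph with edge variables $\{x_e: e\in E\}$ and vertex variables $\{y_v : v\in V\}$. Let $H$ be the corresponding Schrödinger matrix on $G$ and $\mathcal{H}$ its lift to the spanning tree graph $\mathcal{G}=(\mathcal{V},\mathcal{E})$. Then $$\det \mathcal{H} = \prod_{W} \det\big(H^{(V\setminus W)}\big)^{m(W)},$$ where the product ranges over all strongly connected subsets $W\subseteq V$ (including $W=V$) and $H^{(V\setminus W)}$ denotes $H$ with the rows and columns corresponding to $V\setminus W$ removed.
   Context: Simple means no loops and no multiple edges. A spanning tree of $G$ is a directed spanning tree rooted at some vertex, with all edges directed towards the root (every non-root vertex has exactly one outgoing edge in the tree, the root has none). A spanning forest rooted in $W\subseteq V$ is a set of edges in which each vertex outside $W$ has exactly one outgoing edge, vertices of $W$ have none, and following outgoing edges from any vertex leads to a vertex of $W$. The spanning tree graph $\mathcal{G}=(\mathcal{V},\mathcal{E})$: $\mathcal{V}$ is the set of spanning trees of $G$; for $t_i,t_j\in\mathcal{V}$ with roots $i,j$, $(t_i,t_j)\in\mathcal{E}$ iff $t_j$ is obtained from $t_i$ by adding the edge $(i,j)$ and removing the outgoing edge from $j$. Schrödinger matrix on $G$: $H := Q+Y$, indexed by $V$, where $Q(i,j)=-x_{(i,j)}$ if $(i,j)\in E$, $Q(i,i)=\sum_{k:(i,k)\in E}x_{(i,k)}$, all other entries of $Q$ are $0$, and $Y=\mathrm{diag}(y_v)_{v\in V}$. Lift: $\mathcal{H}:=\mathcal{Q}+\mathcal{Y}$, indexed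 by $\mathcal{V}$, where $\mathcal{Q}(t_i,t_j)=-x_{(i,j)}$ if $(t_i,t_j)\in\mathcal{E}$ with $t_i,t_j$ rooted at $i,j$; $\mathcal{Q}(t_i,t_i)=-\sum_{t\neq t_i}\mathcal{Q}(t_i,t)$; all other entries of $\mathcal{Q}$ are $0$; and $\mathcal{Y}$ is diagonal with $(t_i,t_i)$ entry $y_i$, where $i$ is the root of $t_i$. A subset $W\subseteq V$ is strongly connected if the subgraph of $G$ induced on $W$ is strongly connected (single vertices are strongly connected; the empty set may be included or omitted, since the determinant of the empty matrix is $1$). The integers $m(W)$ are defined recursively for strongly connected $W\subseteq V$ by $m(V):=1$ and, for $W\ne V$, $m(W):=k(W)-\sum_{W'\supsetneq W}m(W')$, where the sum is over strongly connected subsets $W'$ of $V$ properly containing $W$ and $k(W)$ is the number of spanning forests of $G$ rooted in $W$. *)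

(* Defs.v *)
From mathcomp Require Import all_boot all_order all_algebra.
From mathcomp Require Import mpoly.

Set Implicit Arguments.
Unset Strict Implicit.
Unset Printing Implicit Defensive.

Import GRing.Theory.
Local Open Scope ring_scope.

(* A simple directed graph on V is an irreflexive g : rel V; an edge (i, j) is
   directed from i to j. *)

Section Graph.
Variables (V : finType) (g : rel V).

(* The induced subgraph on W is strongly connected. The empty set satisfies
   this; it contributes only a factor 1 to the product over W, and never occurs
   in the sum over proper supersets defining tree_mult. *)
Definition strongly_connected (W : {set V}) : bool :=
  [forall i in W, forall j in W,
     connect [rel a b | [&& a \in W, b \in W & g a b]] i j].

Definition spanning_forest (W : {set V}) (F : {set V * V}) : bool :=
  [&& [forall e in F, g e.1 e.2],
      [forall v, #|[set e in F | e.1 == v]| == (v \notin W)] &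
      [forall v, exists w in W, connect [rel a b | (a, b) \in F] v w]].

Definition spanning_tree (r : V) (F : {set V * V}) : bool :=
  spanning_forest [set r] F.

(* A spanning tree is stored with its root. The edge set determines the root
   (the only vertex without outgoing edge), so no tree is counted twice. *)
Definition tree : finType :=
  {t : V * {set V * V} | spanning_tree t.1 t.2}.

Definition root_of (t : tree) : V := (sval t).1.
Definition edges_of (t : tree) : {set V * V} := (sval t).2.

Definition tree_edge (s t : tree) : bool :=
  g (root_of s) (root_of t) &&
  (edges_of t ==
     [set e in (root_of s, root_of t) |: edges_of s | e.1 != root_of t]).

Definition forest_count (W : {set V}) : nat :=
  #|[set F | spanning_forest W F]|.

(* n bounds the recursion depth; tree_multE shows that tree_mult satisfies the
   intended recursion over strongly connected proper supersets. *)
Fixpoint tree_mult_rec (n : nat) (W : {set V}) : int :=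
  if n is n'.+1 then
    if W == [set: V] then 1
    else (forest_count W)%:Z
         - \sum_(W' : {set V} | strongly_connected W' && (W \proper W'))
              tree_mult_rec n' W'
  else 0.

Definition tree_mult (W : {set V}) : int := tree_mult_rec #|V|.+1 W.

Lemma tree_mult_rec_stable n W :
  (#|~: W| < n)%N -> tree_mult_rec n W = tree_mult_rec n.+1 W.
Proof.
elim: n W => // n IHn W ltWn.
rewrite [LHS]/= [RHS]/=; case: eqP => // _; congr (_ - _).
apply: eq_bigr => W' /andP[_ ltWW']; rewrite IHn //.
by apply: leq_trans (proper_card _) _; last exact: ltWn; rewrite properC.
Qed.

Lemma tree_multT : tree_mult [set: V] = 1.
Proof. by rewrite /tree_mult /= eqxx. Qed.

Lemma tree_multE W : W != [set: V] ->
  tree_mult W = (forest_count W)%:Z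
    - \sum_(W' : {set V} | strongly_connected W' && (W \proper W'))
         tree_mult W'.
Proof.
move=> WnT; rewrite {1}/tree_mult [LHS]/= (negPf WnT); congr (_ - _).
apply: eq_bigr => W' /andP[_ ltWW']; apply: tree_mult_rec_stable.
rewrite -(cardsC W') -[X in (X < _)%N]add0n ltn_add2r card_gt0.
by apply/set0Pn; have [_ [v vW' _]] := properP ltWW'; exists v.
Qed.

End Graph.

Section Matrices.
Variables (R : idomainType) (V : finType) (g : rel V).

(* One indeterminate for each edge and one for each vertex. *)
Definition variable : finType := ({e : V * V | g e.1 e.2} + V)%type.
Definition coef_ring : idomainType := {mpoly R[#|{: variable}|]}.

(* The default value 0 is used only when (i, j) is not an edge. *)
Definition xvar (i j : V) : coef_ring :=
  if insub (i, j) is Some e then 'X_(enum_rank (inl e : variable)) else 0.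
Definition yvar (v : V) : coef_ring := 'X_(enum_rank (inr v : variable)).

Definition laplacian_entry (i j : V) : coef_ring :=
  if i == j then \sum_(k | g i k) xvar i k
  else if g i j then - xvar i j else 0.

Definition schrodinger : 'M[coef_ring]_#|V| :=
  \matrix_(a, b) (laplacian_entry (enum_val a) (enum_val b)
                  + (yvar (enum_val a)) *+ (a == b)).

Definition lift_offdiag (s t : tree g) : coef_ring :=
  if tree_edge s t then - xvar (root_of s) (root_of t) else 0.

Definition lift_laplacian_entry (s t : tree g) : coef_ring :=
  if s == t then - \sum_(u | u != s) lift_offdiag s u else lift_offdiag s t.

Definition lift_schrodinger : 'M[coef_ring]_#|{: tree g}| :=
  \matrix_(a, b) (lift_laplacian_entry (enum_val a) (enum_val b)
                  + (yvar (root_of (enum_val a))) *+ (a == b)).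

End Matrices.

(* M with the rows and columns corresponding to S removed. *)
Definition del_rows_cols (K : Type) (V : finType) (M : 'M[K]_#|V|)
    (S : {set V}) : 'M[K]_#|~: S| :=
  let f (a : 'I_#|~: S|) := enum_rank (enum_val a) in mxsub f f M.

(* Main.v *)
Require Import Defs.
From mathcomp Require Import all_boot all_order all_algebra.
From mathcomp Require Import perm mpoly.

(** Both sides are compared through traces of powers, that is, through weighted
    closed walks.

    Write the Schrödinger matrix as [1 - b], where [b] is a matrix of step
    weights: a step from [i] either moves along an edge or stays at [i]. Its
    lift is [1 - lift_mx g b], and a step of the lift from a tree rooted at [i]
    is determined by the step of its root. Hence a walk in the tree graph is a
    starting tree together with a walk [p] of the root in [g]. Along [p], each
    visited vertex forgets its outgoing edge and keeps the edge by which [p]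
    last leaves it; unvisited vertices keep their edge. So when [p] is closed
    with set of visited vertices [U], the starting trees to which the walk
    returns are the forests rooted in [U], completed by the last exits of [p]
    ([card_fixed_trees]). Consequently the trace of a power of the lift is the
    sum over closed walks of their weight times [forest_count g U].

    The set [U] is strongly connected, and the recursion defining the
    multiplicities says that [forest_count g U] is the sum of [tree_mult g W]
    over the strongly connected [W] containing [U] ([forest_count_sum]). Since
    the closed walks inside [W] give the traces of the powers of the submatrix
    of [b] on [W], exchanging the two sums yields [trace_lift_induced]: the
    traces of the powers of the lift are those of the submatrices of [b],
    counted with multiplicities [tree_mult g W].

    Over a ring without integer torsion, the traces of the powers of [A]
    determine [det (1 - X A)], because they are, up to sign, the coefficients
    of its logarithmic derivative ([rev_char_poly_log_deriv],
    [has_log_deriv_inj]). Setting [X = 1] gives the factorization with the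
    negative multiplicities moved to the other side
    ([det_lift_torsion_free]). An arbitrary coefficient ring [R] may have
    positive characteristic, so this is applied to polynomials with integer
    coefficients and the resulting identity is mapped to polynomials over [R].
    Finally the determinants on the right are nonzero, because they become [1]
    when all edge variables are set to [0] and all vertex variables to [1], so
    the factors can be moved back as negative powers in the fraction field. *)

Set Implicit Arguments.
Unset Strict Implicit.
Unset Printing Implicit Defensive.

Import GRing.Theory.
Local Open Scope ring_scope.

(** * Traces of powers and the reversed characteristic polynomial *)

Section Newton.
Variable K : comNzRingType.
Implicit Types (p q : {poly K}) (tau sigma : nat -> K).

Lemma deriv_prod (I : eqType) (r : seq I) (F : I -> {poly K}) : uniq r ->
  (\prod_(k <- r) F k)^`() =
  \sum_(i <- r) \prod_(k <- r) (if k == i then (F k)^`() else F k).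
Proof.
elim: r => [|a r IHr] /=; first by rewrite !big_nil derivC.
case/andP=> ar /IHr{}IHr; rewrite !big_cons derivM IHr eqxx mulr_sumr.
congr (_ * _ + _).
  by apply: eq_big_seq => k kr; case: eqP => // ka; rewrite -ka kr in ar.
apply: eq_big_seq => i ir; rewrite big_cons.
by case: eqP => // ai; rewrite ai ir in ar.
Qed.

(** Jacobi's formula: by multilinearity the derivative of the determinant is the
    sum over rows [i] of the determinant with row [i] differentiated, which is
    then expanded along that row. *)
Lemma deriv_det n (M : 'M[{poly K}]_n) :
  (\det M)^`() = \tr (\adj M *m map_mx (@deriv K) M).
Proof.
pose N i := \matrix_(k, j) (if k == i then (M k j)^`() else M k j).
have detN i : \det (N i) = \sum_j (M i j)^`() * cofactor M i j.
  rewrite (expand_det_row _ i); apply: eq_bigr => j _.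
  rewrite mxE eqxx /cofactor; congr (_ * (_ * \det _)).
  by apply/matrixP=> a b; rewrite !mxE eq_sym (negPf (neq_lift i a)).
have -> : (\det M)^`() = \sum_i \det (N i).
  rewrite [\det M]/(\det M) /determinant raddf_sum exchange_big /=.
  apply: eq_bigr => s _; rewrite -mulr_sumr !mulr_sign.
  have dprod : (\prod_i M i (s i))^`() = \sum_i \prod_k N i k (s k).
    rewrite deriv_prod ?index_enum_uniq //.
    by apply: eq_bigr => i _; apply: eq_bigr => k _; rewrite mxE.
  by case: (_ s); rewrite ?derivN dprod.
rewrite /mxtrace (eq_bigr _ (fun i _ => detN i)) exchange_big /=.
apply: eq_bigr => j _; rewrite mxE; apply: eq_bigr => i _.
by rewrite !mxE mulrC.
Qed.

(** The power series identity [p' = p * \sum_l tau l X^l], stated coefficientwise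
    with truncated series, which keeps it inside the ring of polynomials. *)
Definition has_log_deriv p tau :=
  forall N k, (k < N)%N -> p^`()`_k = (p * \poly_(i < N) tau i)`_k.

Lemma coefM_eqr p q q' k :
  (forall i, (i <= k)%N -> q`_i = q'`_i) -> (p * q)`_k = (p * q')`_k.
Proof.
by move=> eqq; rewrite !coefM; apply: eq_bigr => i _; rewrite eqq ?leq_subr.
Qed.

Lemma has_log_deriv1 : has_log_deriv 1 (fun _ => 0).
Proof.
move=> N k _; rewrite derivC coef0 mul1r coef_poly.
by case: ifP.
Qed.

Lemma has_log_derivM p q tau sigma : has_log_deriv p tau ->
  has_log_deriv q sigma -> has_log_deriv (p * q) (fun i => tau i + sigma i).
Proof.
move=> ptau qsigma N k ltkN.
have -> : \poly_(i < N) (tau i + sigma i) =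
          \poly_(i < N) tau i + \poly_(i < N) sigma i.
  by apply/polyP=> i; rewrite !coefE; case: ifP; rewrite ?addr0.
rewrite derivM coefD.
have -> : (p^`() * q)`_k = (p * \poly_(i < N) tau i * q)`_k.
  rewrite ![_ * q]mulrC; apply: coefM_eqr => i ik.
  by apply/ptau/(leq_ltn_trans ik).
have -> : (p * q^`())`_k = (p * (q * \poly_(i < N) sigma i))`_k.
  by apply: coefM_eqr => i ik; apply/qsigma/(leq_ltn_trans ik).
by rewrite -coefD mulrDr mulrAC mulrA.
Qed.

Lemma has_log_derivX p tau n : has_log_deriv p tau ->
  has_log_deriv (p ^+ n) (fun i => tau i *+ n).
Proof.
move=> ptau; elim: n => [|n IHn]; first exact: has_log_deriv1.
move=> N k ltkN; rewrite exprS (has_log_derivM ptau IHn ltkN).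
by congr ((_ * _ : {poly K})`_k); apply/polyP=> i; rewrite !coef_poly mulrS.
Qed.

Lemma has_log_deriv_prod (I : Type) (r : seq I) (P : pred I)
    (p : I -> {poly K}) (tau : I -> nat -> K) :
  (forall i, P i -> has_log_deriv (p i) (tau i)) ->
  has_log_deriv (\prod_(i <- r | P i) p i)
                (fun l => \sum_(i <- r | P i) tau i l).
Proof.
move=> ptau; elim: r => [|i r IHr] N k ltkN.
  rewrite big_nil (has_log_deriv1 ltkN); congr ((_ * _ : {poly K})`_k).
  by apply/polyP=> i; rewrite !coef_poly big_nil.
rewrite big_cons; case: ifP => Pi; last first.
  rewrite (IHr _ _ ltkN); congr ((_ * _ : {poly K})`_k).
  by apply/polyP=> j; rewrite !coef_poly big_cons Pi.
rewrite (has_log_derivM (ptau i Pi) IHr ltkN); congr ((_ * _ : {poly K})`_k).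
by apply/polyP=> j; rewrite !coef_poly big_cons Pi.
Qed.

(** The characteristic polynomial with its coefficients reversed. *)
Definition rev_char_poly n (A : 'M[K]_n) : {poly K} :=
  \det (1%:M - 'X *: map_mx polyC A).

(** With [M = 1 - X A], Jacobi's formula gives [(det M)' = - tr (adj M A)]. The
    geometric sum [\sum_(l < N) X^l A^(l+1)] is the inverse of [M] times [A] up
    to a multiple of [X^N], so multiplying it by [adj M * M = det M] recovers
    [adj M A] up to order [N]. *)
Lemma rev_char_poly_log_deriv n (A : 'M[K]_n) :
  has_log_deriv (rev_char_poly A) (fun l => - \tr (A ^+ l.+1)).
Proof.
move=> N k ltkN; rewrite /rev_char_poly; set Ap := map_mx polyC A.
set M := _ - _.
have dM : map_mx (@deriv K) M = - Ap.
  apply/matrixP=> i j; rewrite !mxE derivB derivM derivX !derivC mulr0 addr0.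
  by rewrite mul1r raddfMn /= derivC mul0rn sub0r.
have telescope : M *m \sum_(l < N) 'X^l *: Ap ^+ l.+1 = Ap - 'X^N *: Ap ^+ N.+1.
  elim: {ltkN} N => [|N IHN].
    by rewrite big_ord0 mulmx0 expr0 scale1r expr1 subrr.
  rewrite big_ord_recr /= mulmxDr IHN mulmxBl mul1mx -scalemxAl -scalemxAr.
  by rewrite scalerA -exprS [Ap ^+ N.+2]exprS addrA subrK.
have trS : \poly_(l < N) - \tr (A ^+ l.+1) =
           - \tr (\sum_(l < N) 'X^l *: Ap ^+ l.+1).
  rewrite (raddf_sum (@mxtrace _ _)) -sumrN poly_def; apply: eq_bigr => l _ /=.
  rewrite mxtraceZ scaleNr -mul_polyC mulrC; congr (- (_ * _)).
  by rewrite -trace_map_mx rmorphXn.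
have -> : \det M * \poly_(l < N) - \tr (A ^+ l.+1) =
          (\det M)^`() + 'X^N * \tr (\adj M *m Ap ^+ N.+1).
  rewrite trS deriv_det dM mulmxN raddfN /= mulrN -mxtraceZ -mul_scalar_mx.
  rewrite -mul_adj_mx -mulmxA telescope mulmxBr raddfB /= opprB addrC.
  by rewrite -scalemxAr mxtraceZ.
by rewrite coefD coefXnM ltkN addr0.
Qed.

Lemma rev_char_poly0 n (A : 'M[K]_n) : (rev_char_poly A)`_0 = 1.
Proof.
rewrite -horner_coef0 /rev_char_poly -[_.[0]]/(horner_eval 0 _) -det_map_mx.
rewrite -[RHS](det1 K n); congr (\det _); apply/matrixP=> i j.
rewrite !mxE /= /horner_eval hornerD hornerN hornerM hornerX mul0r subr0.
by case: (i == j); rewrite ?hornerC.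
Qed.

Lemma rev_char_poly_horner1 n (A : 'M[K]_n) :
  (rev_char_poly A).[1] = \det (1%:M - A).
Proof.
rewrite /rev_char_poly -[_.[1]]/(horner_eval 1 _) -det_map_mx.
congr (\det _); apply/matrixP=> i j.
rewrite !mxE /= /horner_eval hornerD hornerN hornerM hornerX mul1r hornerC.
by case: (i == j); rewrite ?hornerC.
Qed.

(** The coefficient of index [k + 1], multiplied by [k + 1], is a function of
    [tau] and of the coefficients up to [k]; the hypothesis on [K] allows to
    cancel [k + 1]. *)
Lemma has_log_deriv_inj p q tau :
    (forall n (x : K), x *+ n.+1 = 0 -> x = 0) ->
  has_log_deriv p tau -> has_log_deriv q tau -> p`_0 = q`_0 -> p = q.
Proof.
move=> char0 ptau qtau p0; apply/polyP=> k.
elim/ltn_ind: k => -[|k] // IHk.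
apply/eqP; rewrite -subr_eq0; apply/eqP/(char0 k); rewrite mulrnBl.
rewrite -!coef_deriv (ptau k.+1) // (qtau k.+1) // mulrC [q * _]mulrC.
by apply/eqP; rewrite subr_eq0; apply/eqP/coefM_eqr => i ik; apply: IHk.
Qed.

End Newton.

(** * Matrix powers as sums over walks *)

(** A walk of length [l] is the list of the vertices after its starting point.
    All lists are allowed: those that do not follow edges get weight [0]. *)
Fixpoint walks (V : finType) (l : nat) : seq (seq V) :=
  if l is l'.+1 then [seq v :: p | v <- index_enum V, p <- walks V l']
  else [:: [::]].

(** The entries of [M ^+ l] are sums over walks on [V], where [V] acts on a set
    of states [S] through [step]. Two instances are used: the states are vertices
    (for a submatrix) or rooted trees (for the lift), both driven by the same
    walk of a vertex. The matrix need not involve all states: it suffices that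
    steps leaving the image of [phi] have weight [0], which is what [M_step]
    expresses. *)
Section Powers.
Variables (K : comNzRingType) (V : finType) (S : eqType).
Variables (step : S -> V -> S) (wt : S -> V -> K).

Fixpoint walk_weight (s : S) (p : seq V) : K :=
  if p is v :: p' then wt s v * walk_weight (step s v) p' else 1.

Variables (n : nat) (M : 'M[K]_n) (phi : 'I_n -> S).
Hypothesis M_step : forall a (X : S -> K),
  \sum_b M a b * X (phi b) = \sum_v wt (phi a) v * X (step (phi a) v).

Lemma mx_power_walks l a (X : S -> K) :
  \sum_b (M ^+ l) a b * X (phi b) =
  \sum_(p <- walks V l) walk_weight (phi a) p * X (foldl step (phi a) p).
Proof.
elim: l a => [|l IHl] a.
  rewrite big_seq1 (bigD1 a) //= big1 ?addr0 => [|b /negPf ab].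
    by rewrite !mxE eqxx.
  by rewrite !mxE eq_sym ab mul0r.
transitivity (\sum_c M a c * \sum_b (M ^+ l) c b * X (phi b)).
  under eq_bigr => b _ do rewrite exprS mxE mulr_suml.
  rewrite exchange_big; apply: eq_bigr => c _ /=.
  by rewrite mulr_sumr; apply: eq_bigr => b _; rewrite mulrA.
under eq_bigr => c _ do rewrite IHl.
rewrite (M_step _ (fun s => \sum_(p <- walks V l)
  walk_weight s p * X (foldl step s p))) big_allpairs_dep.
apply: eq_bigr => v _; rewrite mulr_sumr.
by apply: eq_bigr => p _ /=; rewrite mulrA.
Qed.

Lemma trace_power_walks l : injective phi ->
  \tr (M ^+ l) = \sum_a \sum_(p <- walks V l)
    walk_weight (phi a) p *+ (foldl step (phi a) p == phi a).
Proof.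
move=> phi_inj; apply: eq_bigr => a _.
have := mx_power_walks l a (fun s => (s == phi a)%:R).
rewrite (bigD1 a) //= eqxx mulr1 big1 ?addr0 => [->|b /negPf ab].
  by apply: eq_bigr => p _; rewrite mulr_natr.
by rewrite (inj_eq phi_inj) ab mulr0.
Qed.

End Powers.

(** * Walks of the root and the trees they produce *)

Section Walks.
Variables (V : finType) (g : rel V).
Implicit Types (r v w j : V) (F : {set V * V}) (W U : {set V}) (p : seq V).

Definition stay_or_move : rel V := [rel a b | (a == b) || g a b].

(** The move of the root of a tree, on all pairs of a vertex and an edge set, so
    that it also applies to forests and along arbitrary lists of vertices. *)
Definition tree_step (s : V * {set V * V}) (j : V) :=
  if j == s.1 then s else (j, [set e in (s.1, j) |: s.2 | e.1 != j]).

Lemma tree_step1 s j : (tree_step s j).1 = j.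
Proof. by rewrite /tree_step; case: eqP. Qed.

Lemma tree_walk1 s p : (foldl tree_step s p).1 = last s.1 p.
Proof. by elim: p s => //= j p IHp s; rewrite IHp tree_step1. Qed.

Lemma forest_root W F e : spanning_forest g W F -> e.1 \in W -> e \notin F.
Proof.
case/and3P=> _ /forallP/(_ e.1) deg _ eW; apply/negP=> eF.
move: deg; rewrite eW /= cards_eq0 => /eqP/setP/(_ e).
by rewrite !inE eF eqxx.
Qed.

(** A path to [W] reaches the larger set [U] before using an edge that leaves
    [U], so deleting these edges keeps [U] reachable. *)
Lemma forest_restrict W U F : W \subset U -> spanning_forest g W F ->
  spanning_forest g U [set e in F | e.1 \notin U].
Proof.
move=> sWU /and3P[/'forall_implyP edges /forallP deg /forallP conn].
apply/and3P; split.
- by apply/'forall_implyP => e; rewrite inE => /andP[/edges].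
- apply/forallP=> v; case: (boolP (v \in U)) => vU /=.
    rewrite cards_eq0; apply/eqP/setP=> e; rewrite !inE.
    by apply/negP=> /andP[/andP[_ eU] /eqP ev]; rewrite ev vU in eU.
  have := deg v; rewrite (contra (subsetP sWU v) vU) => /eqP degv.
  apply/eqP; rewrite -[RHS]degv; congr #|pred_of_set _|.
  apply/setP=> e; rewrite !inE.
  by case: (e.1 =P v) => [->|]; rewrite ?vU ?andbT ?andbF.
apply/forallP=> v; have /exists_inP[w wW /connectP[p vp def_w]] := conn v.
rewrite {w}def_w in wW; elim: p v vp wW => [|u p IHp] v /=.
  by move=> _ /(subsetP sWU) vU; apply/exists_inP; exists v.
case/andP=> vu up lastW; case: (boolP (v \in U)) => vU.
  by apply/exists_inP; exists v.
have /exists_inP[w wU uw] := IHp u up lastW.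
apply/exists_inP; exists w => //; apply: connect_trans uw.
by apply: connect1; rewrite /= inE vu.
Qed.

(** A path of [F] to [W] that meets [j] may stop there, one that avoids [j] is
    preserved, and from the former root [r] the added edge leads to [j]. For
    [W = [set r]] this says that trees move to trees; the general case is what
    completes a forest to a tree in [card_fixed_trees]. *)
Lemma forest_step W F r j : spanning_forest g W F -> r \in W ->
  stay_or_move r j -> spanning_forest g (j |: W :\ r) (tree_step (r, F) j).2.
Proof.
rewrite /tree_step /= => forF rW; case: (eqVneq j r) => [->|jr].
  by rewrite setD1K.
rewrite /stay_or_move /= eq_sym (negPf jr) /= => rj.
have /and3P[/'forall_implyP edges /forallP deg /forallP conn] := forF.
apply/and3P; split.
- apply/'forall_implyP => e; rewrite !inE => /andP[/orP[/eqP->|/edges] //].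
- apply/forallP=> v; rewrite !inE; case: (eqVneq v j) => [->|vj] /=.
    rewrite cards_eq0; apply/eqP/setP=> e; rewrite !inE.
    by case: (e.1 == j); rewrite ?andbF.
  case: (eqVneq v r) => [->|vr] /=.
    apply/eqP/(etrans _ (cards1 (r, j))); congr #|pred_of_set _|.
    apply/setP=> e; rewrite !inE; case: (e =P (r, j)) => [->|_] /=.
      by rewrite eqxx eq_sym jr.
    case: (e.1 =P r) => [er|]; last by rewrite andbF.
    by rewrite (negPf (forest_root forF _)) // er.
  rewrite -(eqP (deg v)); apply/eqP; congr #|pred_of_set _|.
  apply/setP=> e; rewrite !inE; case: (e.1 =P v) => [ev|]; rewrite ?andbF //.
  rewrite ev vj !andbT; case: (e =P (r, j)) => // er.
  by rewrite -ev er eqxx in vr.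
apply/forallP=> v; have /exists_inP[w wW /connectP[p vp def_w]] := conn v.
rewrite {w}def_w in wW; elim: p v vp wW => [|u p IHp] v /=.
  move=> _ vW; apply/exists_inP; case: (eqVneq v r) => [->|vr].
    by exists j; rewrite ?setU11 // connect1 //= !inE eqxx eq_sym.
  by exists v; rewrite // !inE vr vW orbT.
case/andP=> vu up lastW; case: (eqVneq v j) => [->|vj].
  by apply/exists_inP; exists j; rewrite ?setU11.
have /exists_inP[w wU uw] := IHp u up lastW.
apply/exists_inP; exists w => //; apply: connect_trans uw.
by apply: connect1; rewrite /= !inE vu vj orbT.
Qed.

(** Started from a forest, the walk uses up the roots that it visits, until its
    end is the only root left among them. *)
Lemma forest_walk W F r p : spanning_forest g W F -> r \in W ->
  path stay_or_move r p ->
  spanning_forest g (last r p |: W :\: [set x in r :: p])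
                    (foldl tree_step (r, F) p).2.
Proof.
elim: p W F r => [|j p IHp] W F r /= forF rW.
  by move=> _; rewrite set_seq1 setD1K.
case/andP=> rj jp; have := IHp _ _ _ (forest_step forF rW rj) (setU11 _ _) jp.
set s := tree_step (r, F) j; have -> : (j, s.2) = s.
  by rewrite [RHS]surjective_pairing tree_step1.
suff -> : (j |: W :\ r) :\: [set x in j :: p] =
           W :\: [set x in r :: j :: p] by [].
apply/setP=> x; rewrite !inE.
by case: (x == j); case: (x == r); rewrite ?orbT ?andbF.
Qed.

(** At a visited vertex the outgoing edge is the last exit of the walk, or there
    is none at the end of the walk, whatever the initial edges are. *)
Lemma tree_walk_visited F1 F2 r p e :
    (forall f, f.1 = r -> f \notin F1) -> (forall f, f.1 = r -> f \notin F2) ->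
    e.1 \in r :: p ->
  (e \in (foldl tree_step (r, F1) p).2) = (e \in (foldl tree_step (r, F2) p).2).
Proof.
move=> F1r F2r; elim/last_ind: p => [|p j IHp].
  rewrite mem_seq1 => /eqP er /=.
  by rewrite (negPf (F1r _ er)) (negPf (F2r _ er)).
rewrite !foldl_rcons /tree_step !tree_walk1 -/tree_step -rcons_cons.
rewrite mem_rcons in_cons.
have ep_last : j = last r p -> e.1 = j -> e.1 \in r :: p.
  by move=> -> ->; apply: mem_last.
case: (j =P last r p) => [jl|_] /=.
  by case/predU1P=> [/(ep_last jl)|]; apply: IHp.
rewrite !inE; case: (e.1 == j) => /=; first by rewrite !andbF.
by rewrite !andbT => /IHp ->.
Qed.

Lemma tree_walk_unvisited F r p e : e.1 \notin r :: p ->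
  (e \in (foldl tree_step (r, F) p).2) = (e \in F).
Proof.
elim/last_ind: p => [//|p j IHp].
rewrite foldl_rcons /tree_step !tree_walk1 -/tree_step -rcons_cons mem_rcons.
rewrite in_cons negb_or => /andP[ej ep]; case: (j =P last r p) => _.
  exact: IHp.
rewrite !inE ej andbT IHp //; case: eqP => // def_e.
by case/negP: ep; rewrite def_e; apply: mem_last.
Qed.

(** Running the walk maps the forests rooted in the set [U] of visited vertices
    bijectively to the trees fixed by the walk: it adds the last exits at the
    vertices of [U] and leaves the other vertices alone, and a fixed tree is
    recovered from its restriction to the complement of [U]. *)
Lemma card_fixed_trees r p : path stay_or_move r p ->
  #|[set F | spanning_tree g r F & foldl tree_step (r, F) p == (r, F)]|
  = ((last r p == r) * forest_count g [set x in r :: p])%N.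
Proof.
move=> rp; case: eqP => [lastr|lastr]; last first.
  apply/eqP; rewrite mul0n cards_eq0; apply/eqP/setP=> F; rewrite !inE.
  apply/negP=> /andP[_ /eqP/(congr1 fst)]; rewrite tree_walk1.
  exact: lastr.
set U := [set x in _]; have rU : r \in U by rewrite !inE eqxx.
rewrite mul1n; pose run F := (foldl tree_step (r, F) p).2.
have runE F : foldl tree_step (r, F) p = (r, run F).
  by rewrite [LHS]surjective_pairing tree_walk1 /= lastr.
have root_free W F : r \in W -> spanning_forest g W F ->
  forall f, f.1 = r -> f \notin F.
  by move=> rW forF f fr; apply: (forest_root forF); rewrite fr.
have unvisited F e : e.1 \notin U -> (e \in run F) = (e \in F).
  by rewrite inE; apply: tree_walk_unvisited.
have run_inj : {in [set F | spanning_forest g U F] &, injective run}.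
  move=> F1 F2; rewrite !inE => for1 for2 eq12; apply/setP=> e.
  case: (boolP (e.1 \in U)) => eU.
    by rewrite !(negPf (forest_root _ eU)).
  by rewrite -(unvisited F1) // eq12 unvisited.
rewrite /forest_count -(card_in_imset run_inj); congr #|pred_of_set _|.
apply/setP=> G; rewrite !inE; apply/andP/imsetP=> [[treeG]|[F]].
  rewrite runE => /eqP[runG]; exists [set e in G | e.1 \notin U].
    by rewrite inE (forest_restrict _ treeG) // sub1set.
  apply/setP=> e; case: (boolP (e.1 \in U)) => eU; last first.
    by rewrite unvisited // inE eU andbT.
  rewrite -[in LHS]runG; apply: tree_walk_visited; last by rewrite inE in eU.
    by apply: root_free treeG; rewrite set11.
  by move=> f fr; rewrite inE fr rU andbF.
rewrite inE => forF ->.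
have treeG : spanning_tree g r (run F).
  by have := forest_walk forF rU rp; rewrite lastr setDv setU0.
split=> //; rewrite runE; apply/eqP; congr (_, _); apply/setP=> e.
case: (boolP (e.1 \in U)) => eU; last by rewrite unvisited.
apply: tree_walk_visited; last by rewrite inE in eU.
  by apply: root_free treeG; rewrite set11.
exact: root_free forF.
Qed.

Lemma closed_walk_strongly_connected r p :
    path stay_or_move r p -> last r p = r ->
  strongly_connected g [set x in r :: p].
Proof.
move=> rp lastr; set U := [set x in _].
set e := [rel a b | [&& a \in U, b \in U & g a b]].
have conn v q : path stay_or_move v q -> {subset v :: q <= U} ->
  {in v :: q, forall x, connect e v x /\ connect e x (last v q)}.
  elim: q v => [|u q IHq] v /=.
    by move=> _ _ x; rewrite inE => /eqP->.
  case/andP=> vu uq sqU x; rewrite inE.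
  have su : {subset u :: q <= U} by move=> y yq; rewrite sqU // inE yq orbT.
  have cvu : connect e v u.
    move: vu; rewrite /stay_or_move /= => /predU1P[->//|gvu].
    apply: connect1 => /=.
    by rewrite gvu sqU ?mem_head // su ?mem_head.
  have [_ cul] := IHq u uq su u (mem_head _ _).
  case/predU1P=> [->|/(IHq u uq su)[cux cxl]].
    by split=> //; apply: connect_trans cul.
  by split=> //; apply: connect_trans cux.
have sU : {subset r :: p <= U} by move=> x xp; rewrite in_set.
apply/forall_inP=> x; rewrite in_set => /(conn _ _ rp sU)[_ cxr].
apply/forall_inP=> y; rewrite in_set => /(conn _ _ rp sU)[cry _].
by apply: connect_trans cry; rewrite -[X in connect _ _ X]lastr.
Qed.

Lemma forest_countT : forest_count g [set: V] = 1%N.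
Proof.
rewrite /forest_count -(cards1 (set0 : {set V * V})); congr #|pred_of_set _|.
apply/setP=> F; rewrite !inE; apply/idP/eqP=> [forF|->].
  by apply/setP=> e; rewrite inE (negPf (forest_root forF _)) ?inE.
apply/and3P; split; first by apply/'forall_implyP => e; rewrite inE.
  by apply/forallP=> v; rewrite inE cards_eq0; apply/eqP/setP=> e; rewrite !inE.
by apply/forallP=> v; apply/exists_inP; exists v.
Qed.

(** The recursion for [tree_mult], solved for [forest_count]. *)
Lemma forest_count_sum U : strongly_connected g U ->
  (forest_count g U)%:Z =
  \sum_(W : {set V} | strongly_connected g W && (U \subset W)) tree_mult g W.
Proof.
move=> scU; rewrite (bigD1 U) ?scU //=.
under eq_bigl => W do rewrite -andbA [X in _ && X]andbC eq_sym -properEneq.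
have [->|UT] := eqVneq U [set: V]; last by rewrite tree_multE // subrK.
rewrite big1 ?addr0 ?tree_multT ?forest_countT // => W /andP[_].
by rewrite properE subsetT andbF.
Qed.

End Walks.

(** * Traces of the lift and of the induced submatrices *)

(** An exponent of arbitrary sign is split in two, so that the factorization
    can be written without division and transported along ring morphisms. *)
Definition int_pos (m : int) : nat := if m is Posz n then n else 0.
Definition int_neg (m : int) : nat := if m is Negz n then n.+1 else 0.

Lemma int_posB_neg m : m = (int_pos m)%:Z - (int_neg m)%:Z.
Proof. by case: m => n; rewrite ?subr0 ?NegzE ?sub0r. Qed.

Section Traces.
Variables (K : comNzRingType) (V : finType) (g : rel V) (b : V -> V -> K).

Definition lift_mx : 'M[K]_#|{: tree g}| :=
  \matrix_(x, y) (b (root_of (enum_val x)) (root_of (enum_val y)) *+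
    (sval (enum_val y) ==
       tree_step (sval (enum_val x)) (root_of (enum_val y)))).

Definition induced_mx (W : {set V}) : 'M[K]_#|~: ~: W| :=
  \matrix_(x, y) b (enum_val x) (enum_val y).

(** For each [j] that the root may step to there is exactly one tree rooted at
    [j] that follows [s], namely [tree_step (sval s) j]. *)
Lemma sum_tree_step (s : tree g) (c : V -> K) (X : V * {set V * V} -> K) :
    (forall j, ~~ stay_or_move g (root_of s) j -> c j = 0) ->
  \sum_(t : tree g)
     (c (root_of t) *+ (sval t == tree_step (sval s) (root_of t))) * X (sval t)
  = \sum_j c j * X (tree_step (sval s) j).
Proof.
move=> c0; rewrite (partition_big (@root_of V g) predT) //=.
apply: eq_bigr => j _.
case: (boolP (stay_or_move g (root_of s) j)) => sj; last first.
  by rewrite c0 // mul0r big1 // => t /eqP->; rewrite c0 // mul0rn mul0r.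
have treeS : spanning_tree g (tree_step (sval s) j).1 (tree_step (sval s) j).2.
  have := forest_step (valP s) (set11 _) sj.
  by rewrite setDv setU0 -surjective_pairing tree_step1.
pose t : tree g := exist (fun u => spanning_tree g u.1 u.2) _ treeS.
rewrite (bigD1 t) /=; last by rewrite /root_of /= tree_step1.
rewrite /root_of /= tree_step1 eqxx mulr1n big1 ?addr0 //.
move=> u /andP[/eqP uj ut].
case: eqP => [def_u|]; last by rewrite mulr0n mul0r.
by case/eqP: ut; apply: val_inj; rewrite /= def_u uj.
Qed.

Notation weight := (walk_weight (fun _ j => j) b).

Hypothesis b_supp : forall i j, ~~ stay_or_move g i j -> b i j = 0.

Lemma weight_supp r p : ~~ path (stay_or_move g) r p -> weight r p = 0.
Proof.
elim: p r => //= j p IHp r; rewrite negb_and => /orP[/b_supp->|/IHp->].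
  by rewrite mul0r.
by rewrite mulr0.
Qed.

Lemma weight_lift s p :
  walk_weight (@tree_step V) (fun s j => b s.1 j) s p = weight s.1 p.
Proof. by elim: p s => //= j p IHp s; rewrite IHp tree_step1. Qed.

Lemma weight_induced (W : {set V}) r p :
  walk_weight (fun _ j => j) (fun i j => b i j *+ (j \in W)) r p =
  weight r p *+ all (mem W) p.
Proof.
elim: p r => //= j p IHp r.
by rewrite IHp; case: (j \in W); rewrite ?mulr0n ?mul0r // mulrnAr.
Qed.

Lemma trace_lift l :
  \tr (lift_mx ^+ l) = \sum_r \sum_(p <- walks V l)
    weight r p *+ ((last r p == r) * forest_count g [set x in r :: p]).
Proof.
pose phi (x : 'I_#|{: tree g}|) := sval (enum_val x).
rewrite (@trace_power_walks _ _ _ (@tree_step V) (fun s j => b s.1 j)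
  _ _ phi); first last.
- by move=> x y /val_inj/enum_val_inj.
- move=> x X; rewrite -(@sum_tree_step _ (b (phi x).1) X) => [|j /b_supp //].
  rewrite [RHS]big_enum_val /=.
  by apply: eq_bigr => y _; rewrite mxE.
transitivity (\sum_(t : tree g) \sum_(p <- walks V l)
    weight (root_of t) p *+ (foldl (@tree_step V) (sval t) p == sval t)).
  rewrite [RHS]big_enum_val; apply: eq_bigr => x _.
  by apply: eq_bigr => p _; rewrite weight_lift.
transitivity (\sum_(u : V * {set V * V} | spanning_tree g u.1 u.2)
   \sum_(p <- walks V l) weight u.1 p *+ (foldl (@tree_step V) u p == u)).
  rewrite [RHS](reindex_omap (sval : tree g -> _) insub) => [|u treeu];
    last first.
    by rewrite insubT.
  by apply: eq_bigl => t; rewrite (valP t) /= valK eqxx.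
transitivity (\sum_r \sum_(F | spanning_tree g r F) \sum_(p <- walks V l)
    weight r p *+ (foldl (@tree_step V) (r, F) p == (r, F))).
  by rewrite pair_big_dep; apply: eq_big => [[r F]|[r F]].
apply: eq_bigr => r _; rewrite exchange_big; apply: eq_bigr => p _ /=.
case: (boolP (path (stay_or_move g) r p)) => rp; last first.
  by rewrite weight_supp // mul0rn big1 // => F _; rewrite mul0rn.
rewrite -(card_fixed_trees rp) -sum1dep_card -sumrMnr.
rewrite [LHS]big_mkcond [RHS]big_mkcond.
by apply: eq_bigr => F _; case: (spanning_tree _ _ _); case: eqP.
Qed.

Lemma trace_induced (W : {set V}) l :
  \tr (induced_mx W ^+ l) = \sum_r \sum_(p <- walks V l)
    weight r p *+ ((last r p == r) && ([set x in r :: p] \subset W)).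
Proof.
have memW j : (j \in ~: ~: W) = (j \in W) by rewrite setCK.
rewrite (@trace_power_walks _ _ _ (fun _ j => j)
  (fun i j => b i j *+ (j \in W)) _ _ enum_val); first last.
- exact: enum_val_inj.
- move=> x X; transitivity (\sum_(j in ~: ~: W) b (enum_val x) j * X j).
    by rewrite [RHS]big_enum_val; apply: eq_bigr => y _; rewrite mxE.
  rewrite big_mkcond; apply: eq_bigr => j _; rewrite memW.
  by case: ifP => _; rewrite ?mulr0n ?mul0r.
rewrite -(big_enum_val (fun r => \sum_(p <- walks V l)
   walk_weight (fun _ j => j) (fun i j => b i j *+ (j \in W)) r p *+
   (foldl (fun _ j => j) r p == r))) big_mkcond.
apply: eq_bigr => r _; rewrite memW.
have subW p : ([set x in r :: p] \subset W) = (r \in W) && all (mem W) p.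
  rewrite -[RHS]/(all (mem W) (r :: p)).
  by apply/subsetP/allP=> sW x xp; apply: sW; rewrite inE in xp *.
case: ifP => rW; last first.
  by rewrite big1 // => p _; rewrite subW rW andbF.
apply: eq_bigr => p _; rewrite weight_induced subW rW /=.
have -> : foldl (fun _ j : V => j) r p = last r p.
  by elim: p r {subW rW} => //=.
by rewrite -mulrnA mulnb andbC.
Qed.

(** Both sides are sums over closed walks; a walk visiting exactly [U] occurs on
    the right once for every strongly connected [W] containing [U]. *)
Lemma trace_lift_induced l :
  \tr (lift_mx ^+ l) =
  \sum_(W : {set V} | strongly_connected g W)
     \tr (induced_mx W ^+ l) *~ tree_mult g W.
Proof.
rewrite trace_lift; under [RHS]eq_bigr => W _ do rewrite trace_induced.
under [RHS]eq_bigr => W _.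
  rewrite mulrz_suml. under eq_bigr => r _ do rewrite mulrz_suml.
  over.
rewrite [RHS]exchange_big; apply: eq_bigr => r _.
rewrite [RHS]exchange_big; apply: eq_bigr => p _ /=.
case: (boolP (path (stay_or_move g) r p)) => rp; last first.
  by rewrite weight_supp // mul0rn big1 // => W _; rewrite mul0rn mul0rz.
case: (last r p =P r) => [lastr|_]; last first.
  by rewrite big1 //= => W _; rewrite mul0rz.
rewrite mul1n pmulrn forest_count_sum; last first.
  exact: closed_walk_strongly_connected.
rewrite big_mkcondr mulrz_sumr /=; apply: eq_bigr => W _.
by case: ifP => _; rewrite ?mulr0z ?mulr0n ?mul0rz.
Qed.

(** Both sides are values at [1] of products of reversed characteristic
    polynomials, which have equal logarithmic derivatives and constant
    coefficient [1]. *)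
Lemma det_lift_torsion_free :
    (forall n (x : K), x *+ n.+1 = 0 -> x = 0) ->
  \det (1%:M - lift_mx) *
    \prod_(W : {set V} | strongly_connected g W)
       \det (1%:M - induced_mx W) ^+ int_neg (tree_mult g W) =
  \prod_(W : {set V} | strongly_connected g W)
     \det (1%:M - induced_mx W) ^+ int_pos (tree_mult g W).
Proof.
move=> char0.
have prod1 (m : int -> nat) :
    \prod_(W : {set V} | strongly_connected g W)
      \det (1%:M - induced_mx W) ^+ m (tree_mult g W) =
    (\prod_(W : {set V} | strongly_connected g W)
       rev_char_poly (induced_mx W) ^+ m (tree_mult g W)).[1].
  rewrite horner_prod; apply: eq_bigr => W _.
  by rewrite horner_exp rev_char_poly_horner1.
have logW (m : int -> nat) := has_log_deriv_prod (index_enum {set V})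
  (fun W _ => has_log_derivX (m (tree_mult g W))
                (rev_char_poly_log_deriv (induced_mx W))).
have const1 (m : int -> nat) :
    (\prod_(W : {set V} | strongly_connected g W)
       rev_char_poly (induced_mx W) ^+ m (tree_mult g W))`_0 = 1.
  rewrite -horner_coef0 horner_prod big1 // => W _.
  by rewrite horner_exp horner_coef0 rev_char_poly0 expr1n.
rewrite !prod1 -rev_char_poly_horner1 -hornerM; congr _.[_].
apply: (has_log_deriv_inj char0); last 1 first.
- by rewrite coef0M const1 mulr1 const1 rev_char_poly0.
- exact: has_log_derivM (rev_char_poly_log_deriv _) (logW _ int_neg).
move=> N k ltkN; rewrite (logW _ int_pos N k ltkN).
congr ((_ * _ : {poly K})`_k); apply/polyP=> l; rewrite !coef_poly.
case: ifP => // _; rewrite trace_lift_induced -sumrN -big_split /=.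
apply: eq_bigr => W _; rewrite {2}[tree_mult g W]int_posB_neg mulrzBr.
by rewrite -!pmulrn !mulNrn opprB addrAC subrr add0r.
Qed.

End Traces.

(** * The Schrödinger matrix and its lift *)

Lemma map_one_minus_lift_mx (K L : comNzRingType) (f : {rmorphism K -> L})
    (V : finType) (g : rel V) (b : V -> V -> K) :
  map_mx f (1%:M - lift_mx g b) = 1%:M - lift_mx g (fun i j => f (b i j)).
Proof.
rewrite map_mxB map_mx1; congr (_ - _); apply/matrixP=> x y.
by rewrite !mxE raddfMn.
Qed.

Lemma map_one_minus_induced_mx (K L : comNzRingType) (f : {rmorphism K -> L})
    (V : finType) (b : V -> V -> K) (W : {set V}) :
  map_mx f (1%:M - induced_mx b W) = 1%:M - induced_mx (fun i j => f (b i j)) W.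
Proof.
rewrite map_mxB map_mx1; congr (_ - _); apply/matrixP=> x y.
by rewrite !mxE.
Qed.

Section Schrodinger.
Variables (R : idomainType) (V : finType) (g : rel V).

(** The step weights [b] for which [1 - b] is the Schrödinger matrix; the shift
    by the identity makes the determinants values of [det (1 - X b)]. *)
Definition residual (i j : V) : coef_ring R g :=
  (i == j)%:R - (laplacian_entry R g i j + yvar R g i *+ (i == j)).

Lemma residual_supp i j : ~~ stay_or_move g i j -> residual i j = 0.
Proof.
rewrite /stay_or_move /= negb_or => /andP[/negPf ij /negPf gij].
by rewrite /residual /laplacian_entry ij gij addr0 subr0.
Qed.

Lemma one_minus_induced_mx W :
  1%:M - induced_mx residual W = del_rows_cols (schrodinger R g) (~: W).
Proof.
apply/matrixP=> x y; rewrite !mxE !enum_rankK /residual.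
by rewrite (inj_eq enum_rank_inj) (inj_eq enum_val_inj) subKr.
Qed.

(** The diagonal entries agree because each edge leaving the root [i] of a tree
    leads to exactly one other tree, so both Laplacians have the same diagonal
    entry [\sum_k x_(i, k)]. *)
Lemma one_minus_lift_mx : irreflexive g ->
  1%:M - lift_mx g residual = lift_schrodinger R g.
Proof.
move=> g_irr; apply/matrixP=> x y; rewrite !mxE /lift_laplacian_entry.
rewrite (inj_eq enum_val_inj).
set s := enum_val x; set t := enum_val y.
have offdiag (u : tree g) : u != s -> lift_offdiag R s u =
    (if g (root_of s) (root_of u) then - xvar R g (root_of s) (root_of u)
     else 0)
    *+ (sval u == tree_step (sval s) (root_of u)).
  move=> us; rewrite /lift_offdiag /tree_edge /tree_step -/(root_of s).
  case: (root_of u =P root_of s) => [eq_r|neq_r].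
    by rewrite eq_r g_irr mul0rn.
  rewrite [sval u]surjective_pairing xpair_eqE -/(root_of u) eqxx.
  by case: (g _ _); rewrite /= ?mul0rn //; case: (edges_of u == _).
have [xy|xy] := eqVneq x y.
  have st : s = t by rewrite /s xy.
  rewrite -st /tree_step eqxx eqxx !mulr1n /residual /laplacian_entry.
  rewrite eqxx !mulr1n subKr; congr (_ + _); rewrite (eq_bigr _ offdiag).
  pose c j : coef_ring R g :=
    if g (root_of s) j then - xvar R g (root_of s) j else 0.
  have c0 j : ~~ stay_or_move g (root_of s) j -> c j = 0.
    by rewrite /stay_or_move /= negb_or /c => /andP[_ /negPf->].
  have := sum_tree_step (fun=> 1) c0.
  rewrite (bigD1 s) //= {1}/c g_irr mul0rn mul0r add0r.
  under eq_bigr => u _ do rewrite mulr1.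
  move=> ->; rewrite big_mkcond -sumrN; apply: eq_bigr => k _.
  by rewrite mulr1 /c; case: ifP; rewrite ?oppr0 // opprK.
have ts : t != s by rewrite /s /t (inj_eq enum_val_inj) eq_sym.
rewrite offdiag // !mulr0n addr0 sub0r /residual.
have [eq_r|neq_r] := eqVneq (root_of s) (root_of t).
  have -> : (sval t == tree_step (sval s) (root_of t)) = false.
    by rewrite /tree_step -eq_r eqxx; apply: negPf; rewrite (inj_eq val_inj).
  by rewrite !mulr0n oppr0.
rewrite /laplacian_entry (negPf neq_r) !mulr0n addr0 sub0r.
by case: (g _ _); case: (_ == _); rewrite ?mulr0n ?mulr1n ?oppr0 ?opprK.
Qed.

Lemma det_induced_neq0 W :
  \det (del_rows_cols (schrodinger R g) (~: W)) != 0.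
Proof.
pose v (i : 'I_#|{: variable g}|) : R := if enum_val i is inl _ then 0 else 1.
suff : meval v (\det (del_rows_cols (schrodinger R g) (~: W))) = 1.
  by apply: contra_eqN => /eqP ->; rewrite meval0 eq_sym oner_eq0.
rewrite -det_map_mx -(det1 R #|~: ~: W|); congr (\det _); apply/matrixP=> x y.
have x0 i j : meval v (xvar R g i j) = 0.
  rewrite /xvar; case: insubP => [e _ _|_]; last by rewrite meval0.
  by rewrite mevalXU /v enum_rankK.
rewrite !mxE !enum_rankK (inj_eq enum_rank_inj) (inj_eq enum_val_inj).
have lap0 i j : meval v (laplacian_entry R g i j) = 0.
  rewrite /laplacian_entry; case: ifP => _.
    by rewrite rmorph_sum big1 // => k _; apply: x0.
  by case: ifP => _; rewrite ?rmorphN /= ?x0 ?oppr0 ?meval0.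
have y1 i : meval v (yvar R g i) = 1 by rewrite mevalXU /v enum_rankK.
by rewrite rmorphD raddfMn /= lap0 y1 add0r.
Qed.

End Schrodinger.

Lemma map_residual (R : idomainType) (V : finType) (g : rel V) i j :
  map_mpoly (intr : int -> R) (residual int g i j) = residual R g i j.
Proof.
have mapx k l : map_mpoly (intr : int -> R) (xvar int g k l) = xvar R g k l.
  by rewrite /xvar; case: insub => [e|]; rewrite ?rmorph0 ?map_mpolyX.
have mapl : map_mpoly (intr : int -> R) (laplacian_entry int g i j) =
            laplacian_entry R g i j.
  rewrite /laplacian_entry; case: ifP => _.
    by rewrite rmorph_sum; apply: eq_bigr => k _; apply: mapx.
  by case: ifP => _; rewrite ?rmorph0 // rmorphN /= mapx.
have map1 : map_mpoly (intr : int -> R) (1 : coef_ring int g) = 1.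
  exact: rmorph1.
by rewrite /residual rmorphB rmorphD !raddfMn /= map1 mapl map_mpolyX.
Qed.

Lemma mpoly_int_torsion_free n k (p : {mpoly int[n]}) : p *+ k.+1 = 0 -> p = 0.
Proof.
move=> pk0; apply/mpolyP=> m; apply/eqP; rewrite mcoeff0.
have := congr1 (mcoeff m) pk0; rewrite mcoeffMn mcoeff0 => /eqP.
by rewrite Num.Theory.mulrn_eq0.
Qed.

(** The integer case maps to an arbitrary coefficient ring because the
    multiplicities do not depend on [R]. *)
Lemma det_lift_schrodinger (R : idomainType) (V : finType) (g : rel V) :
    irreflexive g ->
  \det (lift_schrodinger R g) *
    \prod_(W : {set V} | strongly_connected g W)
       \det (del_rows_cols (schrodinger R g) (~: W)) ^+ int_neg (tree_mult g W) =
  \prod_(W : {set V} | strongly_connected g W)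
     \det (del_rows_cols (schrodinger R g) (~: W)) ^+ int_pos (tree_mult g W).
Proof.
move=> g_irr; pose f : {rmorphism coef_ring int g -> coef_ring R g} :=
  [the {rmorphism coef_ring int g -> coef_ring R g}
     of map_mpoly (intr : int -> R)].
have := congr1 f (@det_lift_torsion_free (coef_ring int g) _ _ _
  (@residual_supp int V g) (@mpoly_int_torsion_free _)).
have fres : (fun i j => f (residual int g i j)) =2 residual R g.
  exact: map_residual.
have fW W : f (\det (1%:M - induced_mx (residual int g) W)) =
            \det (del_rows_cols (schrodinger R g) (~: W)).
  rewrite -det_map_mx map_one_minus_induced_mx -one_minus_induced_mx.
  by congr (\det (_ - _)); apply/matrixP=> x y; rewrite !mxE fres.
have fL : f (\det (1%:M - lift_mx g (residual int g))) =
          \det (lift_schrodinger R g).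
  rewrite -det_map_mx map_one_minus_lift_mx -one_minus_lift_mx //.
  by congr (\det (_ - _)); apply/matrixP=> x y; rewrite !mxE fres.
have fprod (m : int -> nat) :
    f (\prod_(W : {set V} | strongly_connected g W)
         \det (1%:M - induced_mx (residual int g) W) ^+ m (tree_mult g W)) =
    \prod_(W : {set V} | strongly_connected g W)
       \det (del_rows_cols (schrodinger R g) (~: W)) ^+ m (tree_mult g W).
  rewrite rmorph_prod; apply: eq_bigr => W _.
  by rewrite -fW; apply: rmorphXn.
by rewrite rmorphM fL !fprod.
Qed.

Theorem corollary4p4 (R : idomainType) (V : finType) (g : rel V)
    (g_simple : irreflexive g) (g_conn : strongly_connected g [set: V]) :
  tofrac (\det (lift_schrodinger R g)) =
  \prod_(W : {set V} | strongly_connected g W)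
     tofrac (\det (del_rows_cols (schrodinger R g) (~: W))) ^ tree_mult g W.
Proof.
pose D (W : {set V}) := tofrac (\det (del_rows_cols (schrodinger R g) (~: W))).
have D0 W : D W != 0 by rewrite tofrac_eq0 det_induced_neq0.
have := congr1 (@tofrac _) (det_lift_schrodinger R g_simple).
rewrite rmorphM !rmorph_prod.
under eq_bigr => W _ do rewrite rmorphXn -/(D W).
under [RHS]eq_bigr => W _ do rewrite rmorphXn -/(D W).
move=> detE; apply: (mulIf _ (etrans detE _)).
  by apply/prodf_neq0 => W _; apply: expf_neq0 (D0 W).
rewrite -big_split; apply: eq_bigr => W _ /=; rewrite -/(D W).
rewrite !exprnP -expfzDr //; congr (_ ^ _).
by apply/eqP; rewrite -subr_eq -int_posB_neg.
Qed.
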